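(* Let $E=\mathbb{Q}(\sqrt{-1})$ and $\mathfrak{O}=\mathbb{Z}[\sqrt{-1}]$. The Hermitian $\mathfrak{O}$-lattice $\langle 1,1\rangle\perp\begin{pmatrix}2&1\\1&2\end{pmatrix}$ is $2$-universal.
   Context: A Hermitian $\mathfrak{O}$-lattice is a finitely generated $\mathfrak{O}$-submodule $L$ of a finite-dimensional $E$-vector space equipped with a form $H$ that is linear in the first variable, satisfies $H(x,y)=\overline{H(y,x)}$ (bar is complex conjugation), and has $H(L,L)\subseteq\mathfrak{O}$. Its rank is $\dim_E EL$; binary means rank 2. It is positive (definite) if $H(v):=H(v,v)>0$ for all $0\neq v\in L$. Here every lattice is free ($\mathfrak{O}$ is a PID); the Gram matrix of a lattice with basis $v_1,\dots,v_n$ is $M_L=(H(v_i,v_j))$, and a lattice is identified with its Gram matrix. $\langle a_1,\dots,a_n\rangle$ denotes the lattice with diagonal Gram matrix with entries $a_1,\dots,a_n$, and $\perp$ denotes orthogonal sum. $L$ represents $\ell$ if $M_\ell=XM_LX^*$ for some matrix $X$ over $\mathfrak{O}$, where $X^*$ is the conjugate transpose. A positive Hermitian $\mathfrak{O}$-lattice is $2$-universal if it represents all binary positive Hermitian $\mathfrak{O}$-lattices. *)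

(* Defs.v *)
From mathcomp Require Import all_boot all_order all_algebra all_field.

Set Implicit Arguments.
Unset Strict Implicit.
Unset Printing Implicit Defensive.

Import Order.TTheory GRing.Theory Num.Theory.
Local Open Scope ring_scope.
Local Open Scope sesquilinear_scope.

(* The ring Z[sqrt(-1)], realised inside algC so that complex conjugation is   *)
(* the library's Num.conj.                                                    *)
Definition gaussInt :=
  [qualify a z : algC | ('Re z \is a Num.int) && ('Im z \is a Num.int)].

(* Z[sqrt(-1)] is a principal ideal domain, so every Hermitian lattice is free *)
(* and is identified with its Gram matrix (H(v_i, v_j)) in a basis: a lattice  *)
(* of rank n is an n x n matrix over algC satisfying the predicate below, its  *)
(* vectors are the Gaussian-integer row vectors of coordinates, and            *)
(* H(x, y) = x M y^*, which is linear in the first variable.                   *)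
Definition hermitian_lattice n (M : 'M[algC]_n) : Prop :=
  M \is a mxOver gaussInt /\ M \is hermsymmx.

Definition lattice_form n (M : 'M[algC]_n) (x y : 'rV[algC]_n) : algC :=
  (x *m M *m y ^t*) 0 0.

(* In algC, 0 < z means that z is real and positive.                           *)
Definition positive_lattice n (M : 'M[algC]_n) : Prop :=
  hermitian_lattice M /\
  forall x : 'rV[algC]_n, x \is a mxOver gaussInt -> x != 0 ->
    0 < lattice_form M x x.

Definition represents n m (L : 'M[algC]_n) (l : 'M[algC]_m) : Prop :=
  exists2 X : 'M[algC]_(m, n), X \is a mxOver gaussInt & l = X *m L *m X ^t*.

Definition two_universal n (L : 'M[algC]_n) : Prop :=
  positive_lattice L /\
  forall l : 'M[algC]_2, positive_lattice l -> represents L l.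

Definition diag_lattice n (a : n.-tuple algC) : 'M[algC]_n :=
  diag_mx (\row_i tnth a i).

Definition gram2 (a b c d : algC) : 'M[algC]_2 :=
  \matrix_(i, j) nth 0 (nth [::] [:: [:: a; b]; [:: c; d]] i) j.

Definition orthogonal_sum m n (L : 'M[algC]_m) (K : 'M[algC]_n) :
  'M[algC]_(m + n) := block_mx L 0 0 K.

(* Main.v *)
Require Import Defs.
From HB Require Import structures.
From mathcomp Require Import all_boot all_order all_algebra all_field.
From mathcomp Require Import ring zify.

(** Write L for the lattice of the theorem, and view a vector of its second
    summand as s theta + t delta divided by 2, where theta and delta are the sum
    and the difference of the two basis vectors: they are orthogonal, of norms 6
    and 2, and (s + t) / 2, (s - t) / 2 must be Gaussian integers.  Hence L
    represents a binary lattice l as soon as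
        2 l = 3 s s^* + t t^* + 2 y1 y1^* + 2 y2 y2^*
    with columns s, t, y1, y2 over Z[i] and s = t modulo 2.  Choosing
    s = (1, 0), the question becomes whether 2 l - 3 s s^* is represented by
    <1, 2, 2> with a congruence on the first column.  Dividing the second basis
    vector by 1 + i turns this into a question about a representation of
        N = (2 c - 3, (1 + i) b; . , a),     l = (c, b; . , a),
    as a sum of three squares x1 x1^* + x2 x2^* + x3 x3^*: the first coordinates
    of x2 and x3 must be divisible by 1 + i.

    Two facts finish the argument.

    - Every positive binary Hermitian lattice over Z[i] is represented by
      <1, 1, 1> ([three_squares_binary]).  A binary lattice whose determinant d
      has a prime factor p allowing it (p^2 | d, or p | a and p | c) is contained
      in a lattice of smaller determinant.  When no prime allows this, d is
      squarefree and the adjugate form takes a value congruent to -1 modulo d,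
      first modulo each prime and then by the Chinese remainder theorem.  That
      value says that the lattice sits in a ternary lattice of determinant 1,
      and reduction theory shows that the only such lattice is <1, 1, 1>
      ([unimodular_ternary]).

    - Since 2 c - 3 is odd, an odd number of the three first coordinates is
      prime to 1 + i.  If all three are, two of the columns are congruent modulo
      1 + i by the pigeonhole principle applied to the second coordinates, and a
      unitary matrix with denominator 1 + i acting on these two columns makes
      their first coordinates even ([rotate_columns]).

    The lattice N is positive for every reduced l with c the larger diagonal
    entry, apart from (1, 0; 0, 1) and (2, b; . , 2) with |b|^2 = 1 or 2, which
    L visibly represents ([target_has_gram2]). *)

Set Implicit Arguments.
Unset Strict Implicit.
Unset Printing Implicit Defensive.
Import Order.TTheory GRing.Theory Num.Theory.
Local Open Scope ring_scope.
Local Open Scope sesquilinear_scope.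

(** * The ring of Gaussian integers *)

(** Gaussian integers are pairs of integers, rather than elements of algC, so
    that congruences and inequalities between real and imaginary parts are
    statements about int. *)
Record gauss := Gauss {gre : int; gim : int}.
Definition gauss_pair z := (gre z, gim z).
Definition pair_gauss (u : int * int) := Gauss u.1 u.2.
Lemma gauss_pairK : cancel gauss_pair pair_gauss. Proof. by case. Qed.
HB.instance Definition _ := Choice.copy gauss (can_type gauss_pairK).

Definition gadd z w := Gauss (gre z + gre w) (gim z + gim w).
Definition gopp z := Gauss (- gre z) (- gim z).
Definition gmul z w :=
  Gauss (gre z * gre w - gim z * gim w) (gre z * gim w + gim z * gre w).
Definition gconj z := Gauss (gre z) (- gim z).

Fact gaddA : associative gadd.
Proof. by move=> [a b] [c d] [e f]; congr Gauss => /=; ring. Qed.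
Fact gaddC : commutative gadd.
Proof. by move=> [a b] [c d]; congr Gauss => /=; ring. Qed.
Fact gadd0 : left_id (Gauss 0 0) gadd.
Proof. by move=> [a b]; congr Gauss => /=; ring. Qed.
Fact gaddN : left_inverse (Gauss 0 0) gopp gadd.
Proof. by move=> [a b]; congr Gauss => /=; ring. Qed.
HB.instance Definition _ := GRing.isZmodule.Build gauss gaddA gaddC gadd0 gaddN.

Fact gmulA : associative gmul.
Proof. by move=> [a b] [c d] [e f]; congr Gauss => /=; ring. Qed.
Fact gmulC : commutative gmul.
Proof. by move=> [a b] [c d]; congr Gauss => /=; ring. Qed.
Fact gmul1 : left_id (Gauss 1 0) gmul.
Proof. by move=> [a b]; congr Gauss => /=; ring. Qed.
Fact gmulD : left_distributive gmul gadd.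
Proof. by move=> [a b] [c d] [e f]; congr Gauss => /=; ring. Qed.
Fact gone0 : Gauss 1 0 != 0. Proof. by []. Qed.
HB.instance Definition _ :=
  GRing.Zmodule_isComNzRing.Build gauss gmulA gmulC gmul1 gmulD gone0.

Fact gconj_additive : zmod_morphism gconj.
Proof. by move=> [a b] [c d]; congr Gauss => /=; ring. Qed.
HB.instance Definition _ := GRing.isZmodMorphism.Build gauss gauss gconj gconj_additive.
Fact gconj_multiplicative : monoid_morphism gconj.
Proof. by split=> [|[a b] [c d]] //; congr Gauss => /=; ring. Qed.
HB.instance Definition _ :=
  GRing.isMonoidMorphism.Build gauss gauss gconj gconj_multiplicative.

Lemma intr_gauss (n : int) : n%:~R = Gauss n 0.
Proof.
have nat_gauss (k : nat) : k%:R = Gauss k%:Z 0.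
  by elim: k => // k IHk; rewrite -natr1 IHk; congr Gauss => /=; lia.
case: n => k; first exact: nat_gauss.
by rewrite NegzE mulrNz -pmulrn nat_gauss; congr Gauss => /=; lia.
Qed.

Lemma gauss_eqP (z w : gauss) : gre z = gre w -> gim z = gim w -> z = w.
Proof. by case: z w => [a b] [c d] /= -> ->. Qed.

Lemma greD (z w : gauss) : gre (z + w) = gre z + gre w. Proof. by []. Qed.
Lemma gimD (z w : gauss) : gim (z + w) = gim z + gim w. Proof. by []. Qed.
Lemma greN (z : gauss) : gre (- z) = - gre z. Proof. by []. Qed.
Lemma gimN (z : gauss) : gim (- z) = - gim z. Proof. by []. Qed.
Lemma greM (z w : gauss) : gre (z * w) = gre z * gre w - gim z * gim w.
Proof. by []. Qed.
Lemma gimM (z w : gauss) : gim (z * w) = gre z * gim w + gim z * gre w.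
Proof. by []. Qed.
Lemma gre_conj (z : gauss) : gre (gconj z) = gre z. Proof. by []. Qed.
Lemma gim_conj (z : gauss) : gim (gconj z) = - gim z. Proof. by []. Qed.
Lemma gre_int (n : int) : gre n%:~R = n. Proof. by rewrite intr_gauss. Qed.
Lemma gim_int (n : int) : gim n%:~R = 0. Proof. by rewrite intr_gauss. Qed.
Lemma gre1 : gre 1 = 1. Proof. by []. Qed.
Lemma gim1 : gim 1 = 0. Proof. by []. Qed.
Lemma gre0 : gre 0 = 0. Proof. by []. Qed.
Lemma gim0 : gim 0 = 0. Proof. by []. Qed.
Lemma greMz (n : int) z : gre (n%:~R * z) = n * gre z.
Proof. by rewrite greM gre_int gim_int mul0r subr0. Qed.
Lemma gimMz (n : int) z : gim (n%:~R * z) = n * gim z.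
Proof. by rewrite gimM gre_int gim_int mul0r addr0. Qed.
(* greMz and gimMz come first to avoid the null terms that greM would create. *)
Definition gaussE := (greMz, gimMz, greD, gimD, greN, gimN, greM, gimM,
  gre_conj, gim_conj, gre_int, gim_int, gre1, gim1, gre0, gim0).

Lemma gconjK : involutive gconj.
Proof. by case=> a b; rewrite /gconj /= opprK. Qed.

Lemma gintr_inj (m n : int) : m%:~R = n%:~R :> gauss -> m = n.
Proof. by rewrite !intr_gauss => -[]. Qed.

Definition gnorm (z : gauss) : int := gre z * gre z + gim z * gim z.

Lemma mul_gconj z : z * gconj z = (gnorm z)%:~R.
Proof. by apply: gauss_eqP; rewrite !gaussE /gnorm; ring. Qed.

Lemma gnormM z w : gnorm (z * w) = gnorm z * gnorm w.
Proof. by rewrite /gnorm !gaussE; lia. Qed.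

Lemma gnorm_conj z : gnorm (gconj z) = gnorm z.
Proof. by rewrite /gnorm !gaussE; lia. Qed.

Lemma gnorm_ge0 z : 0 <= gnorm z.
Proof. by rewrite /gnorm; nia. Qed.

Lemma gconj_int (n : int) : gconj n%:~R = n%:~R.
Proof. by rewrite rmorph_int. Qed.

(** * Gram matrices of vectors of a Hermitian lattice *)

Definition hform n (M : 'M[gauss]_n) (x y : 'rV[gauss]_n) : gauss :=
  (x *m M *m (map_mx gconj y)^T) 0 0.

Definition self_adjoint n (M : 'M[gauss]_n) := M = (map_mx gconj M)^T.

Section HermitianForm.
Variables (n : nat) (M : 'M[gauss]_n).
Hypothesis adjM : self_adjoint M.
Implicit Types x y : 'rV[gauss]_n.

Lemma hformDl x y z : hform M (x + y) z = hform M x z + hform M y z.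
Proof. by rewrite /hform !mulmxDl mxE. Qed.
Lemma hformZl a x y : hform M (a *: x) y = a * hform M x y.
Proof. by rewrite /hform -!scalemxAl mxE. Qed.
Lemma hformC x y : hform M y x = gconj (hform M x y).
Proof.
have conj00 (A : 'M[gauss]_1) : gconj (A 0 0) = ((map_mx gconj A)^T) 0 0.
  by rewrite !mxE.
rewrite /hform conj00 !map_mxM !trmx_mul -adjM mulmxA; congr ((_ *m _ *m _) 0 0).
  by apply/matrixP=> i j; rewrite !mxE; exact/esym/gconjK.
Qed.
Lemma hformDr x y z : hform M z (x + y) = hform M z x + hform M z y.
Proof. by rewrite hformC hformDl rmorphD /= -!hformC. Qed.
Lemma hformZr a x y : hform M x (a *: y) = gconj a * hform M x y.
Proof. by rewrite hformC hformZl rmorphM /= -hformC. Qed.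
Definition hformE := (hformDl, hformDr, hformZl, hformZr).

(** A binary lattice is given by the entries a, b, c of its Gram matrix
    (a, b; conj b, c); the diagonal entries are integers. *)
Definition has_gram2 (a : int) b (c : int) :=
  exists x y, [/\ hform M x x = a%:~R, hform M x y = b & hform M y y = c%:~R].

Lemma has_gram2_swap a b c : has_gram2 c (gconj b) a -> has_gram2 a b c.
Proof. by case=> x [y [xx xy yy]]; exists y, x; rewrite (hformC x y) xy gconjK. Qed.

(** The shears and swaps generate the changes of basis that are needed; this one
    replaces the second basis vector y by y + z x. *)
Lemma has_gram2_shear z a b c :
  has_gram2 a (b + a%:~R * gconj z) (c + 2 * gre (z * b) + a * gnorm z) ->
  has_gram2 a b c.
Proof.
case=> x [y [xx xy yy]]; exists x, (y + (- z) *: x).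
have yx : hform M y x = gconj b + z * a%:~R.
  by rewrite (hformC x) xy rmorphD rmorphM /= gconjK rmorph_int mulrC.
rewrite xx !hformE xx xy yy yx; split=> //; rewrite !rmorphN; first by ring.
apply: gauss_eqP; rewrite /gnorm !gaussE; lia.
Qed.

(** Passage to an overlattice: the hypothesis concerns the lattice in which the
    second basis vector has been divided by w. *)
Lemma has_gram2_scale w a b c :
  has_gram2 a b c -> has_gram2 a (b * gconj w) (c * gnorm w).
Proof.
case=> x [y [xx xy yy]]; exists x, (w *: y).
rewrite !hformE xx xy yy; split=> //; first by rewrite mulrC.
by rewrite mulrA mul_gconj -intrM mulrC.
Qed.

(** The Gram matrix is (a, p, q; . , m, r; . , . , k). *)
Definition has_gram3 (a : int) p q (m : int) r (k : int) :=
  exists u v w, [/\ hform M u u = a%:~R, hform M v v = m%:~R & hform M w w = k%:~R]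
    /\ [/\ hform M u v = p, hform M u w = q & hform M v w = r].

Lemma has_gram3_swap12 a p q m r k : has_gram3 m (gconj p) r a q k -> has_gram3 a p q m r k.
Proof.
case=> u [v [w [[uu vv ww] [uv uw vw]]]]; exists v, u, w.
by rewrite (hformC u v) uv gconjK.
Qed.
Lemma has_gram3_swap23 a p q m r k : has_gram3 a q p k (gconj r) m -> has_gram3 a p q m r k.
Proof.
case=> u [v [w [[uu vv ww] [uv uw vw]]]]; exists u, w, v.
by rewrite (hformC v w) vw gconjK.
Qed.
Lemma has_gram3_shear12 z a p q m r k :
  has_gram3 a (p + a%:~R * gconj z) q (m + 2 * gre (z * p) + a * gnorm z) (r + z * q) k
  -> has_gram3 a p q m r k.
Proof.
case=> u [v [w [[uu vv ww] [uv uw vw]]]]; exists u, (v + (- z) *: u), w.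
have vu : hform M v u = gconj p + z * a%:~R.
  by rewrite (hformC u) uv rmorphD rmorphM /= gconjK rmorph_int mulrC.
rewrite !hformE uu ww uv uw vw vv vu; split; split=> //; rewrite ?rmorphN; try by ring.
by apply: gauss_eqP; rewrite /gnorm !gaussE; lia.
Qed.
Lemma has_gram3_shear23 z a p q m r k :
  has_gram3 a p (q + p * gconj z) m (r + m%:~R * gconj z)
    (k + 2 * gre (z * r) + m * gnorm z) -> has_gram3 a p q m r k.
Proof.
case=> u [v [w [[uu vv ww] [uv uw vw]]]]; exists u, v, (w + (- z) *: v).
have wv : hform M w v = gconj r + z * m%:~R.
  by rewrite (hformC v) vw rmorphD rmorphM /= gconjK rmorph_int mulrC.
rewrite !hformE uu ww uv uw vw vv wv; split; split=> //; rewrite ?rmorphN; try by ring.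
by apply: gauss_eqP; rewrite /gnorm !gaussE; lia.
Qed.

Lemma has_gram3_gram2 a p q m r k : has_gram3 a p q m r k -> has_gram2 a p m.
Proof. by case=> u [v [w [[uu vv ww] [uv uw vw]]]]; exists u, v. Qed.
End HermitianForm.

(** * Ternary unimodular lattices *)

Lemma nearest_multiple (n t : int) : 0 < n ->
  exists k, (2 * (t + n * k) <= n) /\ (- n <= 2 * (t + n * k)).
Proof.
move=> n0; exists (- ((2 * t + n) %/ (2 * n))%Z).
have := divz_eq (2 * t + n) (2 * n).
have := @modz_ge0 (2 * t + n) (2 * n); have := @ltz_pmod (2 * t + n) (2 * n).
set x := (_ %/ _)%Z; set y := (_ %% _)%Z => /(_ ltac:(lia)) h1 /(_ ltac:(lia)) h2 h3.
split; nia.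
Qed.

(** The real and imaginary parts can both be brought into [- n / 2, n / 2]: the
    covering radius of Z[i] is 1 / sqrt 2. *)
Lemma nearest_gauss (n : int) (z : gauss) : 0 < n ->
  exists w, 2 * gnorm (z + n%:~R * gconj w) <= n * n.
Proof.
move=> n0; have [k hk] := nearest_multiple (gre z) n0.
have [l hl] := nearest_multiple (gim z) n0.
exists (Gauss k (- l)); rewrite /gnorm !gaussE /= opprK.
by move: (gre z + _) (gim z + _) hk hl => x y; nia.
Qed.

Lemma gnorm_eq0 (z : gauss) : gnorm z = 0 -> z = 0.
Proof. by rewrite /gnorm => h; apply: gauss_eqP; rewrite ?gre0 ?gim0; nia. Qed.

(** The determinant of (a, p, q; . , m, r; . , . , k). *)
Definition det3 (a : int) p q (m : int) r (k : int) :=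
  a * m * k + 2 * gre (p * r * gconj q) - a * gnorm r - m * gnorm q - k * gnorm p.

(** Together with a m - |p|^2 and a k - |q|^2, the entries of a times the Gram
    matrix of the projection orthogonal to the first basis vector. *)
Definition schur12 (a : int) p q r := a%:~R * r - gconj p * q.

Lemma det3_schur (a m k : int) (p q r : gauss) :
  (a * m - gnorm p) * (a * k - gnorm q) - gnorm (schur12 a p q r)
  = a * det3 a p q m r k.
Proof. by rewrite /det3 /schur12 /gnorm !gaussE; lia. Qed.

(** A lattice of determinant 1 cannot have a basis vector of norm 2 whose inner
    products with all vectors are divisible by 1 + i: this excludes a minimal
    vector of norm 2. *)
Lemma det3_even (m k : int) (p q r : gauss) :
  (2 %| gnorm p)%Z -> (2 %| gnorm q)%Z -> (2 %| (det3 2 p q m r k)%R)%Z.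
Proof.
move=> /dvdzP[s hs] /dvdzP[t ht]; rewrite /det3 hs ht.
apply/dvdzP; exists (m * k + gre (p * r * gconj q) - gnorm r - m * t - k * s).
lia.
Qed.

Lemma self_adjoint1 : self_adjoint (1%:M : 'M[gauss]_3).
Proof. by rewrite /self_adjoint map_mx1 trmx1. Qed.

Lemma hform_id n (x y : 'rV[gauss]_n) :
  hform 1%:M x y = \sum_i x 0 i * gconj (y 0 i).
Proof. by rewrite /hform mulmx1 mxE; apply: eq_bigr => i _; rewrite !mxE. Qed.

(** Here g is the first entry of the (binary, determinant a) projected lattice.
    Reducedness gives a^2 <= 2 g and g^2 <= 2 a, hence a <= 2.  If a = 2, then
    g = 2 and the projected lattice is (2, . ; . , 2) with off-diagonal norm 2,
    which forces |p|^2 and |q|^2 to be even and contradicts [det3_even]. *)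
Lemma reduced_unimodular_ternary (a m k g : int) (p q r : gauss) :
  g = a * m - gnorm p ->
  0 < a -> 0 < g -> det3 a p q m r k = 1 ->
  a <= m -> g <= a * k - gnorm q ->
  2 * gnorm p <= a * a -> 2 * gnorm (schur12 a p q r) <= g * g ->
  has_gram3 (1%:M : 'M[gauss]_3) a p q m r k.
Proof.
move=> gE a0 g0 det1 leam leg hp hG; have detE := det3_schur a m k p q r.
rewrite det1 mulr1 -gE in detE.
have P0 := gnorm_ge0 p; have G0 := gnorm_ge0 (schur12 a p q r).
have h1 : a * a <= 2 * g by nia.
have h2 : g * g <= 2 * a by nia.
have a2 : a <= 2 by nia.
have [a1|a2'] : a = 1 \/ a = 2 by lia.
  have g1 : g = 1 by nia.
  have p0 : p = 0 by apply: gnorm_eq0; nia.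
  have : schur12 a p q r = 0 by apply: gnorm_eq0; nia.
  have m1 : m = 1 by nia.
  have kE : k = 1 + gnorm q by nia.
  rewrite /schur12; subst a p m k.
  rewrite mul1r rmorph0 mul0r subr0 => ->.
  exists (\row_i (i == 0)%:R), (\row_i (i == 1)%:R),
         (\row_i nth 0 [:: gconj q; 0; 1] i).
  rewrite !hform_id !big_ord_recl !big_ord0 !mxE /=.
  split; split; rewrite ?gconjK ?rmorph1 ?rmorph0 //; try ring.
  by rewrite (intrD gauss 1 (gnorm q)) -mul_gconj /=; ring.
exfalso; subst a.
have g2 : g = 2 by nia.
have G2 : gnorm (schur12 2 p q r) = 2 by nia.
have hq : gnorm q = (k - 1) * 2 by nia.
have hp' : gnorm p = (m - 1) * 2 by nia.
have /dvdzP[t] : (2 %| (det3 2 p q m r k)%R)%Z.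
  by apply: det3_even; apply/dvdzP; [exists (m - 1) | exists (k - 1)].
by rewrite det1; lia.
Qed.

(** Reduction decreases lexicographically the norm of the first basis vector and
    then the first entry of the lattice projected orthogonally to it. *)
Lemma unimodular_ternary (a m k : int) (p q r : gauss) :
  0 < a -> 0 < a * m - gnorm p -> det3 a p q m r k = 1 ->
  has_gram3 (1%:M : 'M[gauss]_3) a p q m r k.
Proof.
have adj := self_adjoint1.
have [n] := ubnP `|a|%N; elim: n => // n IHn in a p q m r k *.
have [g] := ubnP (absz (a * m - gnorm p)%R); elim: g => // g IHg in a p q m r k *.
move=> lt_g lt_a a0 g0 det1.
have [z hz] := nearest_gauss (schur12 a p q r) g0.
have [y hy] := nearest_gauss p a0.
apply: (@has_gram3_shear23 _ _ adj z).
apply: (@has_gram3_shear12 _ _ adj y).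
set q1 : gauss := q + _; set k1 : int := k + _ + _; set p2 : gauss := p + _.
set m2 : int := m + _ + _; set r2 : gauss := _ + y * _.
have det2 : det3 a p2 q1 m2 r2 k1 = 1.
  by rewrite -det1 /det3 /r2 /q1 /k1 /p2 /m2 /gnorm !gaussE; lia.
have gE : a * m2 - gnorm p2 = a * m - gnorm p.
  by rewrite /p2 /m2 /gnorm !gaussE; lia.
have projE : schur12 a p2 q1 r2 = schur12 a p q r + (a * m - gnorm p)%:~R * gconj z.
  by apply: gauss_eqP; rewrite /schur12 /p2 /r2 /q1 /gnorm !gaussE; lia.
rewrite -projE -gE in hz; rewrite -gE in lt_g g0.
have detE := det3_schur a m2 k1 p2 q1 r2; rewrite det2 mulr1 in detE.
rewrite -/p2 in hy.
have P0 := gnorm_ge0 p2; have Q0 := gnorm_ge0 q1.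
have G0 := gnorm_ge0 (schur12 a p2 q1 r2).
move: p2 m2 q1 r2 k1 hy hz det2 gE projE lt_g g0 detE P0 Q0 G0 => p2 m2 q1 r2 k1.
move=> hy hz det2 _ _ lt_g g0 detE P0 Q0 G0.
have g2_gt0 : 0 < a * k1 - gnorm q1 by nia.
have [lt2|ge2] := ltrP (a * k1 - gnorm q1) (a * m2 - gnorm p2).
  apply: has_gram3_swap23 => //; apply: IHg => //; first lia.
  by rewrite -det2 /det3 /gnorm !gaussE; lia.
have [ltm|gem] := ltrP m2 a.
  apply: has_gram3_swap12 => //; apply: IHn.
  - nia.
  - nia.
  - by rewrite gnorm_conj mulrC.
  - by rewrite -det2 /det3 /gnorm !gaussE; lia.
exact: (reduced_unimodular_ternary (erefl _)).
Qed.

(** * Arithmetic modulo a prime *)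

Lemma gauss_bezout (x y : gauss) :
  exists g s t u v, [/\ g = s * x + t * y, x = g * u & y = g * v].
Proof.
have [n] := ubnP (absz (gnorm y)); elim: n => // n IHn in x y *.
have [-> _|y0 lt_y] := eqVneq y 0.
  by exists x, 1, 0, 1, 0; split; ring.
have Ny : 0 < gnorm y.
  rewrite lt_def gnorm_ge0 andbT; apply: contraNN y0 => /eqP/gnorm_eq0 ->.
  exact: eqxx.
have [w hw] := nearest_gauss (x * gconj y) Ny.
pose r := x + gconj w * y.
have rE : x * gconj y + (gnorm y)%:~R * gconj w = r * gconj y.
  by rewrite -mul_gconj /r; ring.
rewrite rE gnormM gnorm_conj in hw; have Nr := gnorm_ge0 r.
have lt_r : (absz (gnorm r) < n)%N by nia.
have [g [s [t [u [v [gE yE rE']]]]]] := IHn y r lt_r.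
exists g, t, (s + t * gconj w), (v - gconj w * u), u; split=> //.
  by rewrite gE /r; ring.
by rewrite mulrBr -rE' mulrCA -yE /r; ring.
Qed.

(** The factor g is the gcd of b and p, whose norm divides p^2.  It is not 1,
    since p divides the norm of b, and it is p^2 only if p divides b. *)
Lemma gauss_factor (p : nat) (b : gauss) : prime p ->
  (p%:Z %| gnorm b)%Z -> (exists u, b = p%:~R * u) \/
  exists g u, gnorm g = p%:Z /\ b = g * u.
Proof.
move=> p_pr /dvdzP[k hk].
have [g [s [t [u [v [gE bE pE]]]]]] := gauss_bezout b p%:~R.
have : gnorm g * gnorm v = p%:Z * p%:Z.
  by rewrite -gnormM -pE /gnorm !gaussE; lia.
have Ng := gnorm_ge0 g; have Nv := gnorm_ge0 v => gvE.
have : (absz (gnorm g) %| p ^ 2)%N.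
  by apply/dvdnP; exists (absz (gnorm v)); nia.
case/(dvdn_pfactor _ _ p_pr) => -[|[|[|m]]] //; rewrite ?expn0 ?expn1 -?mulnn => _ Ng'.
- exfalso; have : 1 = gnorm g by lia.
  rewrite gE; have -> : gnorm (s * b + t * p%:~R) =
     p%:Z * (gnorm s * k + 2 * gre (s * b * gconj t) + p%:Z * gnorm t).
    transitivity (gnorm s * gnorm b + p%:Z * (2 * gre (s * b * gconj t) + p%:Z * gnorm t)).
      by rewrite /gnorm !gaussE; lia.
    by rewrite hk; lia.
  move=> h; have : (p%:Z %| 1)%Z by rewrite [X in (_ %| X)%Z]h dvdz_mulr.
  by rewrite dvdzE dvdn1 => /eqP p1; have := prime_gt1 p_pr; lia.
- by right; exists g, u; split=> //; lia.
- left; have Nv1 : gnorm v = 1 by have := prime_gt1 p_pr; nia.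
  exists (gconj v * u); rewrite pE mulrA -(mulrA g) mul_gconj Nv1 mulr1.
  exact: bE.
Qed.

(** The values x^2 and n - y^2 for 0 <= x, y <= p / 2 give two injective families
    in a field of p elements; they meet because 2 (p / 2 + 1) > p. *)
Lemma norm_mod_prime (p : nat) (n : int) : prime p ->
  exists z, (p%:Z %| gnorm z - n)%Z.
Proof.
move=> p_pr; have p1 := prime_gt1 p_pr; pose h := p./2.
have natF (k : nat) : (k%:R == 0 :> 'F_p) = (p %| k)%N.
  by rewrite (dvdn_pcharf (pchar_Fp p_pr)).
pose f (x : 'I_h.+1) : 'F_p := x%:R ^+ 2.
pose g (y : 'I_h.+1) : 'F_p := n%:~R - y%:R ^+ 2.
have f_inj : injective f.
  suff le_f (x y : 'I_h.+1) : (x <= y)%N -> f x = f y -> x = y.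
    move=> x y; have [le_xy|/ltnW le_yx] := leqP x y; first exact: le_f.
    by move=> fxy; apply/esym/le_f.
  move=> le_xy /esym/eqP; rewrite /f -subr_eq0 subr_sqr -natrB // -natrD.
  rewrite mulf_eq0 !natF; have := ltn_ord x; have := ltn_ord y.
  rewrite /h => ley lex dvd; apply: val_inj => /=; apply/eqP.
  rewrite eqn_leq le_xy /=; apply: contraT; rewrite -ltnNge => lt_xy.
  by case/orP: dvd => /dvdn_leq; lia.
have g_inj : injective g by move=> x y /addrI/oppr_inj; exact: f_inj.
have [/existsP[x /existsP[y /eqP xy]]|/existsPn no] :=
    boolP [exists x, [exists y, f x == g y]].
  exists (Gauss x y); rewrite (dvdz_pcharf (pchar_Fp p_pr)) /gnorm /=.
  rewrite intrB intrD !intrM -!pmulrn -!expr2 subr_eq0.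
  by move: xy; rewrite /f /g => ->; rewrite subrK.
pose F (z : 'I_h.+1 + 'I_h.+1) := match z with inl x => f x | inr y => g y end.
have /leq_card : injective F.
  have {}no x y : f x <> g y.
    by move=> fg; have /existsPn/(_ y)/eqP := no x.
  case=> x [] y /=; first by move/f_inj->.
  - by move/no.
  - by move/esym/no.
  - by move/g_inj->.
by rewrite card_Fp // card_sum !card_ord /h; lia.
Qed.

Lemma inv_mod_prime (p : nat) (a : int) : prime p -> ~~ (p%:Z %| a)%Z ->
  exists s, (p%:Z %| 1 - a * s)%Z.
Proof.
move=> p_pr pa; have : coprimez p%:Z a.
  by rewrite coprimezE prime_coprime // -dvdzE.
by case/coprimezP => [[u v] /= uv]; exists v; apply/dvdzP; exists u; lia.
Qed.

(** * Overlattices of smaller determinant *)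

Definition posdef2 (a : int) (b : gauss) (c : int) := 0 < a /\ 0 < a * c - gnorm b.

Section Descent.
Variables (n : nat) (M : 'M[gauss]_n).
Hypothesis adjM : self_adjoint M.

Lemma posdef2_swap a b c : posdef2 a b c -> posdef2 c (gconj b) a.
Proof.
by case=> a0 d0; split; last (rewrite gnorm_conj; lia); have := gnorm_ge0 b; nia.
Qed.

(** If y + z x has inner product with x divisible by p and norm divisible by
    p^2, then (y + z x) / p may be adjoined, which divides the determinant by
    p^2. *)
Lemma descend_shear (p : int) a b c z :
  (forall a' b' c', posdef2 a' b' c' -> a' * c' - gnorm b' < a * c - gnorm b ->
    has_gram2 M a' b' c') ->
  1 < p -> posdef2 a b c ->
  (exists b', b + a%:~R * gconj z = b' * p%:~R) ->
  (exists c', c + 2 * gre (z * b) + a * gnorm z = c' * (p * p)) ->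
  has_gram2 M a b c.
Proof.
move=> IH p1 [a0 d0] [b' bE] [c' cE]; apply: (@has_gram2_shear _ _ adjM z).
have dE : a * c - gnorm b = (a * c' - gnorm b') * (p * p).
  transitivity (a * (c + 2 * gre (z * b) + a * gnorm z) - gnorm (b + a%:~R * gconj z)).
    by rewrite /gnorm !gaussE; lia.
  by rewrite bE cE /gnorm !gaussE; lia.
have := @has_gram2_scale _ M adjM p%:~R a b' c'.
rewrite bE cE gconj_int /gnorm gre_int gim_int mul0r addr0; apply.
have p2 : 1 < p * p by nia.
have D0 : 0 < a * c' - gnorm b' by rewrite dE in d0; move: d0 p2; clear; nia.
by apply: IH; [split|rewrite dE; move: D0 p2; clear; nia].
Qed.

(** As a is invertible modulo p, the form splits modulo p and z can be chosen to
    make y + z x orthogonal to x modulo p.  Then a times its norm is congruent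
    to the determinant modulo p^2. *)
Lemma descend_square (p : nat) a b c :
  (forall a' b' c', posdef2 a' b' c' -> a' * c' - gnorm b' < a * c - gnorm b ->
    has_gram2 M a' b' c') ->
  prime p -> posdef2 a b c -> ~~ (p%:Z %| a)%Z ->
  (p%:Z * p%:Z %| a * c - gnorm b)%Z -> has_gram2 M a b c.
Proof.
move=> IH p_pr abc pa /dvdzP[k dE]; have p1 := prime_gt1 p_pr.
have [s /dvdzP[t st]] := inv_mod_prime p_pr pa.
pose z := (- s)%:~R * gconj b.
have bE : b + a%:~R * gconj z = t%:~R * b * p%:~R.
  have -> : b + a%:~R * gconj z = (1 - a * s)%:~R * b.
    by rewrite /z rmorphM /= gconjK gconj_int; ring.
  by rewrite st; ring.
apply: (@descend_shear p%:Z a b c z) => //; first by exists (t%:~R * b).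
set c1 := c + _ + _.
have ac1 : a * c1 = (k + t * t * gnorm b) * (p%:Z * p%:Z).
  transitivity (a * c - gnorm b + gnorm (b + a%:~R * gconj z)).
    by rewrite /c1 /gnorm !gaussE; lia.
  by rewrite bE dE /gnorm !gaussE; lia.
have cop : coprimez a (p%:Z * p%:Z).
  by rewrite coprimezMr andbb coprimez_sym coprimezE prime_coprime // -dvdzE.
suff /dvdzP[c' ->] : (p%:Z * p%:Z %| c1)%Z by exists c'.
by rewrite -(Gauss_dvdzr _ (_ : coprimez _ a)) 1?coprimez_sym // ac1 dvdz_mull.
Qed.

(** The lattice is p times another one, which takes a value divisible by p since
    norms cover all residues; the corresponding vector can be divided by p. *)
Lemma descend_content (p : nat) a b c :
  (forall a' b' c', posdef2 a' b' c' -> a' * c' - gnorm b' < a * c - gnorm b ->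
    has_gram2 M a' b' c') ->
  prime p -> posdef2 a b c -> (p%:Z %| a)%Z -> (p%:Z %| c)%Z ->
  (exists b', b = p%:~R * b') -> has_gram2 M a b c.
Proof.
move=> IH p_pr abc /dvdzP[a' aE] /dvdzP[c' cE] [b' bE].
have p1 := prime_gt1 p_pr.
have [/dvdzP[a2 a'E]|pa] := boolP (p%:Z %| a')%Z.
  apply: has_gram2_swap => //; apply: (@descend_shear p%:Z _ _ _ 0) => //.
  - by move=> x y w; rewrite gnorm_conj (mulrC c a); exact: IH.
  - exact: posdef2_swap.
  - by exists (gconj b'); rewrite bE rmorphM rmorph0 /= gconj_int; ring.
  - by exists a2; rewrite aE a'E /gnorm !gaussE; lia.
have [s /dvdzP[t st]] := inv_mod_prime p_pr pa.
have [w /dvdzP[u wu]] := norm_mod_prime (gnorm b' - a' * c') p_pr.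
pose z := s%:~R * (gconj w - gconj b').
have zE : b' + a'%:~R * gconj z = w - (t * p%:Z)%:~R * (w - b').
  by rewrite -st /z rmorphM rmorphB /= !gconjK gconj_int; ring.
apply: (@descend_shear p%:Z _ _ _ z) => //.
  by exists (b' + a'%:~R * gconj z); rewrite bE aE; ring.
set c1 := _ + _; pose c2 := c' + 2 * gre (z * b') + a' * gnorm z.
have c1E : c1 = p%:Z * c2.
  by rewrite /c1 /c2 cE bE aE /gnorm !gaussE; lia.
suff /dvdzP[c3 c2E] : (p%:Z %| c2)%Z by exists c3; rewrite c1E c2E; lia.
have cop : coprimez p%:Z a' by rewrite coprimezE prime_coprime // -dvdzE.
rewrite -(Gauss_dvdzr _ cop).
have -> : a' * c2 = a' * c' - gnorm b' + gnorm (b' + a'%:~R * gconj z).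
  by rewrite /c2 /gnorm !gaussE; lia.
rewrite zE; apply/dvdzP.
exists (u - 2 * t * gre (w * gconj (w - b')) + t * t * p%:Z * gnorm (w - b')).
have -> : gnorm (w - (t * p%:Z)%:~R * (w - b')) =
  gnorm w + p%:Z * (- 2 * t * gre (w * gconj (w - b')) + t * t * p%:Z * gnorm (w - b')).
  by rewrite /gnorm !gaussE; lia.
lia.
Qed.

(** Either b is divisible by p as well, or x can be divided by a Gaussian integer
    of norm p. *)
Lemma descend_split (p : nat) a b c :
  (forall a' b' c', posdef2 a' b' c' -> a' * c' - gnorm b' < a * c - gnorm b ->
    has_gram2 M a' b' c') ->
  prime p -> posdef2 a b c -> (p%:Z %| a * c - gnorm b)%Z ->
  (p%:Z %| a)%Z -> (p%:Z %| c)%Z -> has_gram2 M a b c.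
Proof.
move=> IH p_pr abc pd pa pc; have p1 := prime_gt1 p_pr.
have pb : (p%:Z %| gnorm b)%Z.
  have [/dvdzP[k dE] /dvdzP[a' aE]] := (pd, pa).
  by apply/dvdzP; exists (a' * c - k); rewrite aE in dE *; lia.
have [pb'|[g [u [gE bE]]]] := gauss_factor p_pr pb; first exact: descend_content pb'.
case/dvdzP: pa => a' aE; case: abc => a0 d0.
apply: has_gram2_swap => //; have -> : a = a' * gnorm g by rewrite aE gE.
have -> : gconj b = gconj u * gconj g by rewrite bE rmorphM /= mulrC.
apply: has_gram2_scale => //.
have dE : a * c - gnorm b = (c * a' - gnorm (gconj u)) * p%:Z.
  by rewrite aE bE gnormM gE gnorm_conj; lia.
have a'0 : 0 < a' by nia.
have D0 : 0 < c * a' - gnorm (gconj u) by rewrite dE in d0; nia.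
apply: IH; first by split=> //; have := gnorm_ge0 (gconj u); nia.
by rewrite dE; move: D0 p1; clear; nia.
Qed.
End Descent.

(** * Binary lattices are sums of three squares *)

(** The Hermitian form of the adjugate of (a, b; . , c).  The ternary matrix
    (a, b, h1; . , c, h2; . , . , t) has determinant
    t (a c - |b|^2) - adj_form a b c h1 h2. *)
Definition adj_form (a : int) b (c : int) h1 h2 : int :=
  a * gnorm h2 + c * gnorm h1 - 2 * gre (b * h2 * gconj h1).

Lemma adj_form_shift a b c (n : int) h1 h2 x1 x2 : exists k,
  adj_form a b c (h1 + n%:~R * x1) (h2 + n%:~R * x2) = adj_form a b c h1 h2 + n * k.
Proof.
exists (a * (2 * gre (h2 * gconj x2) + n * gnorm x2)
  + c * (2 * gre (h1 * gconj x1) + n * gnorm x1)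
  - 2 * (gre (b * x2 * gconj h1) + gre (b * h2 * gconj x1)
         + n * gre (b * x2 * gconj x1))).
by rewrite /adj_form /gnorm !gaussE; lia.
Qed.

Lemma adj_form_mod_prime (p : nat) a b c : prime p ->
  ~~ (p%:Z %| a)%Z || ~~ (p%:Z %| c)%Z ->
  exists h1 h2, (p%:Z %| adj_form a b c h1 h2 + 1)%Z.
Proof.
move=> p_pr.
have solve (e : int) : ~~ (p%:Z %| e)%Z -> exists z, (p%:Z %| e * gnorm z + 1)%Z.
  move=> /(inv_mod_prime p_pr)[s /dvdzP[t st]].
  have [z /dvdzP[u zu]] := norm_mod_prime (- s) p_pr.
  by exists z; apply/dvdzP; exists (e * u + t); lia.
case/orP => /solve[z hz]; [exists 0, z | exists z, 0].
  have -> : adj_form a b c 0 z = a * gnorm z by rewrite /adj_form /gnorm !gaussE; lia.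
  exact: hz.
have -> : adj_form a b c z 0 = c * gnorm z by rewrite /adj_form /gnorm !gaussE; lia.
exact: hz.
Qed.

Lemma adj_form_mod_squarefree (m : nat) a b c : (0 < m)%N ->
  (forall p : nat, prime p -> (p %| m)%N ->
    ~~ (p%:Z %| a)%Z || ~~ (p%:Z %| c)%Z /\ ~~ (p * p %| m)%N) ->
  exists h1 h2, (m%:Z %| adj_form a b c h1 h2 + 1)%Z.
Proof.
have [n] := ubnP m; elim: n => // n IHn in m *; move=> lt_m m0 hm.
have [m1|m_gt1] := leqP m 1; first by exists 0, 0; rewrite dvdzE (_ : m = 1%N) ?dvd1n //; lia.
have p_pr := pdiv_prime m_gt1; have p1 := prime_gt1 p_pr.
have [pac pp] := hm _ p_pr (pdiv_dvd m).
have /dvdnP[m' mE] := pdiv_dvd m; set p := pdiv m in p_pr p1 pac pp mE.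
have m'0 : (0 < m')%N by lia.
have [k1 [k2 hk]] := adj_form_mod_prime b p_pr pac.
have [||q q_pr qm'|h1 [h2 hh]] := IHn m'; [nia|by []| |].
  have qm : (q %| m)%N by rewrite mE dvdn_mulr.
  have [qac qq] := hm q q_pr qm; split=> //; apply: contra qq.
  by rewrite mE; exact: dvdn_mulr.
have cop : coprimez p%:Z m'%:Z.
  rewrite coprimezE prime_coprime //; apply: contra pp => pm'.
  by rewrite mE dvdn_mul.
case/coprimezP: (cop) => -[u v] /= uv.
pose x1 := v%:~R * (k1 - h1); pose x2 := v%:~R * (k2 - h2).
(* The Chinese remainder: h modulo m', and k modulo p. *)
have swapE (h k : gauss) :
    h + m'%:Z%:~R * (v%:~R * (k - h)) = k + p%:Z%:~R * (u%:~R * (h - k)).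
  have vm : v%:~R * m'%:Z%:~R = 1 - u%:~R * p%:Z%:~R :> gauss.
    by rewrite -!intrM -(intrB gauss 1); congr (_%:~R); lia.
  have -> : h + m'%:Z%:~R * (v%:~R * (k - h)) = h + (v%:~R * m'%:Z%:~R) * (k - h) by ring.
  by rewrite vm; ring.
exists (h1 + m'%:Z%:~R * x1), (h2 + m'%:Z%:~R * x2).
rewrite mE mulnC PoszM Gauss_dvdz //; apply/andP; split.
  rewrite /x1 /x2 !swapE.
  have [k ->] := adj_form_shift a b c p k1 k2 (u%:~R * (h1 - k1)) (u%:~R * (h2 - k2)).
  by case/dvdzP: hk => t ht; apply/dvdzP; exists (t + k); lia.
have [k ->] := adj_form_shift a b c m' h1 h2 x1 x2.
by case/dvdzP: hh => t ht; apply/dvdzP; exists (t + k); lia.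
Qed.

(** The primes to be tested for a possible enlargement are the divisors of the
    determinant; if none is suitable, the adjugate form takes a value
    t d - 1, and t completes a ternary Gram matrix of determinant 1. *)
Theorem three_squares_binary a b c : posdef2 a b c -> has_gram2 (1%:M : 'M[gauss]_3) a b c.
Proof.
have [n] := ubnP (absz (a * c - gnorm b)%R); elim: n => // n IHn in a b c *.
move=> lt_n abc; have [a0 d0] := abc.
have IH a' b' c' : posdef2 a' b' c' -> a' * c' - gnorm b' < a * c - gnorm b ->
    has_gram2 (1%:M : 'M[gauss]_3) a' b' c'.
  by move=> p' lt'; apply: IHn => //; case: p' => _; lia.
pose d := absz (a * c - gnorm b)%R.
have dE : a * c - gnorm b = d%:Z by rewrite /d; lia.
pose bad p := [&& prime p, (p %| d)%N & [&& (p%:Z %| a)%Z & (p%:Z %| c)%Z] || (p * p %| d)%N].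
have [/hasP[p _ /and3P[p_pr pd]]|/hasPn no] := boolP (has bad (iota 0 d.+1)).
  have [/andP[pa pc] _|/=] := boolP (_ && _).
    by apply: (descend_split self_adjoint1 IH p_pr abc) => //; rewrite dE dvdzE.
  rewrite negb_and => /orP[pa|pc] ppd.
    by apply: (descend_square self_adjoint1 IH p_pr abc) => //; rewrite dE -PoszM dvdzE.
  apply: (has_gram2_swap self_adjoint1).
  apply: (descend_square self_adjoint1 _ p_pr (posdef2_swap abc)) => //.
    by move=> a' b' c'; rewrite gnorm_conj (mulrC c); exact: IH.
  by rewrite gnorm_conj mulrC dE -PoszM dvdzE.
have [|p p_pr pd|h1 [h2 /dvdzP[t ht]]] := @adj_form_mod_squarefree d a b c.
- by lia.
- have := no p; rewrite mem_iota /= add0n ltnS dvdn_leq //; last lia.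
  by move=> /(_ isT); rewrite /bad p_pr pd /= negb_or negb_and => /andP[].
apply: (@has_gram3_gram2 _ _ a b h1 c h2 t).
apply: unimodular_ternary => //.
by move: ht; rewrite -dE /det3 /adj_form; lia.
Qed.

(** * The congruence modulo 1 + i *)

Notation one_plus_i := (Gauss 1 1).

(** The residue field modulo 1 + i has two elements, and z = x + i y is in the
    kernel exactly when x + y is even. *)
Definition geven (z : gauss) := (2 %| (gre z + gim z)%R)%Z.

Lemma gevenP z : reflect (exists k, z = one_plus_i * k) (geven z).
Proof.
apply: (iffP dvdzP) => [[t zt]|[k ->]].
  by exists (Gauss t (gim z - t)); apply: gauss_eqP; rewrite !gaussE /=; lia.
by exists (gre k); rewrite !gaussE /=; lia.
Qed.

Lemma geven_norm z : geven z = (2 %| gnorm z)%Z.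
Proof.
rewrite /geven /gnorm; apply/idP/idP => /dvdzP[t ht]; apply/dvdzP.
  exists (2 * t * t - gre z * gim z).
  by rewrite (_ : gre z = t * 2 - gim z); lia.
have even_sqr (x : int) : exists k, x * x = x + 2 * k.
  have [k [->|->]] : exists k, x = 2 * k \/ x = 2 * k + 1.
    by exists (x %/ 2)%Z; lia.
    by exists (2 * k * k - k); lia.
  by exists (2 * k * k + k); lia.
have [k hk] := even_sqr (gre z); have [l hl] := even_sqr (gim z).
by exists (t - k - l); lia.
Qed.

Lemma gevenM z w : geven (z * w) = geven z || geven w.
Proof. by rewrite !geven_norm gnormM !dvdzE abszM Euclid_dvdM. Qed.

Lemma mul_one_plus_i_inj z w : one_plus_i * z = one_plus_i * w -> z = w.
Proof.
move=> h; apply: gauss_eqP.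
  by have := congr1 gre h; have := congr1 gim h; rewrite !gaussE /=; lia.
by have := congr1 gre h; have := congr1 gim h; rewrite !gaussE /=; lia.
Qed.

(** The unitary matrix is (1, e; 1, -e) / (1 + i) with e = 1 or e = i.  It is
    integral on the two columns because they are congruent modulo 1 + i.  With k
    the first coordinate obtained for e = 1, the other choice yields k + i x3, so
    that one of the two choices gives an even first coordinate. *)
Lemma rotate_columns x2 x3 y2 y3 :
  ~~ geven x2 -> ~~ geven x3 -> geven y2 = geven y3 ->
  exists u w s t, [/\ geven u, geven w, gnorm u + gnorm w = gnorm x2 + gnorm x3,
    u * gconj s + w * gconj t = x2 * gconj y2 + x3 * gconj y3
    & gnorm s + gnorm t = gnorm y2 + gnorm y3].
Proof.
move=> odd2 odd3 eqy.
have /gevenP[k kE] : geven (x2 + x3) by move: odd2 odd3; rewrite /geven !gaussE; lia.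
have /gevenP[l lE] : geven (y2 + y3) by move: eqy; rewrite /geven !gaussE; lia.
have -> : x2 = one_plus_i * k - x3 by rewrite -kE; ring.
have -> : y2 = one_plus_i * l - y3 by rewrite -lE; ring.
have [ek|ok] := boolP (geven k).
  exists k, (k - Gauss 1 (-1) * x3), l, (l - Gauss 1 (-1) * y3); split=> //.
  - by move: ek; rewrite /geven !gaussE /=; lia.
  - by rewrite /gnorm !gaussE /=; lia.
  - by apply: gauss_eqP; rewrite !gaussE /=; lia.
  - by rewrite /gnorm !gaussE /=; lia.
exists (k + Gauss 0 1 * x3), (k - x3), (l + Gauss 0 1 * y3), (l - y3); split=> //.
- by move: ok odd3; rewrite /geven !gaussE /=; lia.
- by move: ok odd3; rewrite /geven !gaussE /=; lia.
- by rewrite /gnorm !gaussE /=; lia.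
- by apply: gauss_eqP; rewrite !gaussE /=; lia.
- by rewrite /gnorm !gaussE /=; lia.
Qed.

Lemma hform_id3 (x y : 'rV[gauss]_3) :
  hform 1%:M x y = x 0 0 * gconj (y 0 0) + x 0 1 * gconj (y 0 1)
    + x 0 2%:R * gconj (y 0 2%:R).
Proof.
rewrite hform_id !big_ord_recl big_ord0 addr0 addrA.
have -> : lift ord0 (lift ord0 ord0) = 2%:R :> 'I_3 by apply: val_inj.
by have -> : lift ord0 ord0 = 1 :> 'I_3 by apply: val_inj.
Qed.

(** A representation by three squares in which the first coordinates of the last
    two columns are (1 + i) p and (1 + i) q. *)
Definition adapted_squares a b c := exists u p q y1 y2 y3,
  [/\ gnorm u + 2 * gnorm p + 2 * gnorm q = a,
      u * gconj y1 + one_plus_i * (p * gconj y2 + q * gconj y3) = b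
    & gnorm y1 + gnorm y2 + gnorm y3 = c].

Lemma adapted_squaresI x1 x2 x3 y1 y2 y3 : geven x2 -> geven x3 ->
  adapted_squares (gnorm x1 + gnorm x2 + gnorm x3)
    (x1 * gconj y1 + x2 * gconj y2 + x3 * gconj y3) (gnorm y1 + gnorm y2 + gnorm y3).
Proof.
move=> /gevenP[p ->] /gevenP[q ->]; exists x1, p, q, y1, y2, y3; split=> //.
  by rewrite !gnormM.
by ring.
Qed.

Lemma adapted_squares_odd x1 x2 x3 y1 y2 y3 :
  ~~ geven x2 -> ~~ geven x3 -> geven y2 = geven y3 ->
  adapted_squares (gnorm x1 + gnorm x2 + gnorm x3)
    (x1 * gconj y1 + x2 * gconj y2 + x3 * gconj y3) (gnorm y1 + gnorm y2 + gnorm y3).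
Proof.
move=> o2 o3 /(rotate_columns o2 o3)[u [w [s [t [eu ew xx xy yy]]]]].
have -> : gnorm x1 + gnorm x2 + gnorm x3 = gnorm x1 + gnorm u + gnorm w by lia.
have -> : gnorm y1 + gnorm y2 + gnorm y3 = gnorm y1 + gnorm s + gnorm t by lia.
have -> : x1 * gconj y1 + x2 * gconj y2 + x3 * gconj y3 =
    x1 * gconj y1 + u * gconj s + w * gconj t by rewrite -addrA -xy addrA.
exact: adapted_squaresI.
Qed.

(** An odd number of first coordinates is prime to 1 + i.  If all three are, two
    of the second coordinates are congruent modulo 1 + i, and [rotate_columns]
    applies to these two columns. *)
Lemma adapted_of_has_gram2 a b c : ~~ (2 %| a)%Z ->
  has_gram2 (1%:M : 'M[gauss]_3) a b c -> adapted_squares a b c.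
Proof.
move=> odd_a [x [y []]]; rewrite !hform_id3.
move: (x 0 0) (x 0 1) (x 0 2%:R) (y 0 0) (y 0 1) (y 0 2%:R) => x1 x2 x3 y1 y2 y3.
rewrite !mul_gconj -!intrD => /gintr_inj aE <- /gintr_inj <-.
rewrite -{}aE in odd_a *.
pose P x1 x2 x3 y1 y2 y3 := adapted_squares (gnorm x1 + gnorm x2 + gnorm x3)
    (x1 * gconj y1 + x2 * gconj y2 + x3 * gconj y3) (gnorm y1 + gnorm y2 + gnorm y3).
have rot x1' x2' x3' y1' y2' y3' : P x1' x2' x3' y1' y2' y3' -> P x2' x3' x1' y2' y3' y1'.
  congr adapted_squares; ring.
have odd3 : geven x1 (+) geven x2 (+) geven x3 = false.
  move: odd_a; rewrite !geven_norm; lia.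
rewrite -/(P x1 x2 x3 y1 y2 y3).
case e2: (geven x2) odd3; case e3: (geven x3); case e1: (geven x1) => // _.
- exact: adapted_squaresI.
- by apply: rot; apply: adapted_squaresI.
- by apply/rot/rot; apply: adapted_squaresI.
have [eq23|ne23] := eqVneq (geven y2) (geven y3).
  by apply: adapted_squares_odd => //; rewrite ?e2 ?e3.
have [eq12|ne12] := eqVneq (geven y1) (geven y2).
  by apply: rot; apply: adapted_squares_odd; rewrite ?e1 ?e2.
apply/rot/rot; apply: adapted_squares_odd; rewrite ?e1 ?e3 //.
by case: (geven y1) (geven y2) (geven y3) ne23 ne12 => [] [] [].
Qed.

(** * Representation by the quaternary lattice *)

Definition target_gram : 'M[gauss]_4 := \matrix_(i, j) nth 0 (nth [::]
  [:: [:: 1; 0; 0; 0]; [:: 0; 1; 0; 0]; [:: 0; 0; 2; 1]; [:: 0; 0; 1; 2]] i) j.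

Lemma self_adjoint_target : self_adjoint target_gram.
Proof.
by apply/matrixP => i j; rewrite !mxE; case: i j => [[|[|[|[|?]]]] ?] [[|[|[|[|?]]]] ?].
Qed.

Definition row4 (x1 x2 x3 x4 : gauss) : 'rV[gauss]_4 := \row_i nth 0 [:: x1; x2; x3; x4] i.

Lemma hform_target x1 x2 x3 x4 y1 y2 y3 y4 :
  hform target_gram (row4 x1 x2 x3 x4) (row4 y1 y2 y3 y4) =
  x1 * gconj y1 + x2 * gconj y2 + (2%:R * x3 + x4) * gconj y3
  + (x3 + 2%:R * x4) * gconj y4.
Proof.
rewrite /hform mxE !big_ord_recl big_ord0 !mxE !big_ord_recl !big_ord0 !mxE /=.
ring.
Qed.

(** With u = 1 + 2 k the first coordinate of the odd column, the vectors of L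
    are (p, q, (1 + u) / 2, (1 - u) / 2) and (y2, y3, w, - w), where
    w = conj v comes from the second coordinate z1 = (1 - i) w of that column. *)
Lemma target_has_gram2_of_squares a b c :
  posdef2 (2 * c - 3) (one_plus_i * b) a -> has_gram2 target_gram c b a.
Proof.
move=> /three_squares_binary/adapted_of_has_gram2[]; first by lia.
move=> u0 [p [q [z0 [y2 [y3 [xx xy yy]]]]]].
have odd_u0 : ~~ geven u0 by rewrite geven_norm; lia.
(* Multiplying the odd column by 1 or i makes its first coordinate 1 modulo 2. *)
have [u [z1 [k [uE uu uz zz]]]] : exists u z1 k, [/\ u = 1 + 2%:R * k,
    gnorm u = gnorm u0, u * gconj z1 = u0 * gconj z0 & gnorm z1 = gnorm z0].
  have [odd_re|even_re] := boolP (~~ (2 %| gre u0)%Z).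
    exists u0, z0, (Gauss (gre u0 %/ 2)%Z (gim u0 %/ 2)%Z); split=> //.
    by move: odd_u0; rewrite /geven => odd_u0; apply: gauss_eqP; rewrite !gaussE /=; lia.
  exists (Gauss 0 1 * u0), (Gauss 0 1 * z0), (Gauss (- gim u0 %/ 2)%Z (gre u0 %/ 2)%Z).
  split.
  - by move: odd_u0; rewrite /geven => odd_u0; apply: gauss_eqP; rewrite !gaussE /=; lia.
  - by rewrite gnormM mul1r.
  - by rewrite rmorphM mulrACA [X in X * _](_ : _ = 1) ?mul1r.
  - by rewrite gnormM mul1r.
have odd_u : ~~ geven u by rewrite geven_norm uu -geven_norm.
have /gevenP[v vE] : geven (gconj z1).
  suff : geven (u * gconj z1) by rewrite gevenM (negPf odd_u).
  apply/gevenP; exists (b - (p * gconj y2 + q * gconj y3)).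
  by rewrite uz mulrBr -xy; ring.
have bE : b = p * gconj y2 + q * gconj y3 + u * v.
  by apply: mul_one_plus_i_inj; rewrite -xy -uz vE; ring.
have z1E : gnorm z1 = 2 * gnorm v by rewrite -gnorm_conj vE gnormM.
exists (row4 p q (1 + k) (- k)), (row4 y2 y3 (gconj v) (- gconj v)).
rewrite !hform_target; split.
- have -> : c = gnorm p + gnorm q + (2 + 2 * gre k + 2 * gnorm k).
    have : gnorm u = 1 + 4 * gre k + 4 * gnorm k by rewrite uE /gnorm !gaussE /=; lia.
    by lia.
  by apply: gauss_eqP; rewrite /gnorm !gaussE /=; lia.
- by rewrite bE uE !rmorphN /= gconjK; ring.
- have -> : a = gnorm y2 + gnorm y3 + 2 * gnorm v by lia.
  by apply: gauss_eqP; rewrite /gnorm !gaussE /=; lia.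
Qed.

(** A shear makes 2 |b|^2 <= a^2; if a > c after that, the swap puts a vector of
    smaller norm first. *)
Lemma binary_reduction (P : int -> gauss -> int -> Prop) :
  (forall a b c, P c (gconj b) a -> P a b c) ->
  (forall z a b c,
     P a (b + a%:~R * gconj z) (c + 2 * gre (z * b) + a * gnorm z) -> P a b c) ->
  (forall a b c, posdef2 a b c -> a <= c -> 2 * gnorm b <= a * a -> P a b c) ->
  forall a b c, posdef2 a b c -> P a b c.
Proof.
move=> swapP shearP redP a b c.
have [n] := ubnP (absz a); elim: n => // n IHn in a b c *.
move=> lt_n [a0 d0]; have [z hz] := nearest_gauss b a0.
apply: (shearP z); set c1 := c + _ + _; set b1 := b + _ in hz *.
have d1 : 0 < a * c1 - gnorm b1.
  have -> // : a * c1 - gnorm b1 = a * c - gnorm b.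
  by rewrite /c1 /b1 /gnorm !gaussE; lia.
have [le_ac|lt_ca] := lerP a c1; first by apply: redP => //; split.
have b10 := gnorm_ge0 b1; have c10 : 0 < c1 by nia.
by apply: swapP; apply: IHn; [lia | split=> //; rewrite gnorm_conj mulrC].
Qed.

(** Since 2 |b|^2 <= a^2 and a <= c in a reduced form, the condition
    2 |b|^2 < (2 c - 3) a required by [target_has_gram2_of_squares] only fails
    for (1, 0; 0, 1) and for (2, b; . , 2) with |b|^2 = 1 or 2. *)
Theorem target_has_gram2 a b c : posdef2 a b c -> has_gram2 target_gram a b c.
Proof.
have adj := self_adjoint_target; apply: (binary_reduction (P := has_gram2 target_gram)) => {a b c}.
- by move=> a b c; exact: has_gram2_swap.
- by move=> z a b c; exact: has_gram2_shear.
move=> a b c [a0 d0] le_ac hb; apply: has_gram2_swap => //.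
have [pos|npos] := ltrP (2 * gnorm b) ((2 * c - 3) * a).
  apply: target_has_gram2_of_squares; have b0 := gnorm_ge0 b; split; first by nia.
  by rewrite gnormM gnorm_conj (_ : gnorm one_plus_i = 2) //; lia.
have b0 := gnorm_ge0 b.
have c3 : c <= 3 by nia.
have [[-> -> b00]|[-> -> b1]|[-> -> b2]] : [\/ [/\ a = 1, c = 1 & gnorm b = 0],
    [/\ a = 2, c = 2 & gnorm b = 1] | [/\ a = 2, c = 2 & gnorm b = 2]].
- have [c1|[c2|c3']] : c = 1 \/ c = 2 \/ c = 3 by lia.
  + by apply: Or31; split=> //; nia.
  + have [a1|a2] : a = 1 \/ a = 2 by lia.
      by exfalso; subst; lia.
    have [b1|b2] : gnorm b = 1 \/ gnorm b = 2 by subst; lia.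
      by apply: Or32.
    by apply: Or33.
  + have a123 : a = 1 \/ a = 2 \/ a = 3 by lia.
    by exfalso; case: a123 => [e|[e|e]]; subst; lia.
- exists (row4 1 0 0 0), (row4 0 1 0 0); rewrite !hform_target (gnorm_eq0 b00).
  by split; apply: gauss_eqP.
- exists (row4 0 0 1 0), (row4 0 0 0 b); rewrite !hform_target; split.
  + by apply: gauss_eqP.
  + by rewrite !rmorph0; ring.
  + have := mul_gconj b; rewrite b1 => bb; rewrite !rmorph0.
    transitivity (2%:R * (b * gconj b)); first by ring.
    by rewrite bb.
(* Both parts of b are 1 or -1, so this second vector has norm 2. *)
exists (row4 1 1 0 0), (row4 (gre b)%:~R (Gauss 0 (gim b)) 0 0).
rewrite !hform_target; split.
- by apply: gauss_eqP.
- by apply: gauss_eqP; rewrite !gaussE /=; lia.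
- by apply: gauss_eqP; move: b2; rewrite /gnorm !gaussE /=; lia.
Qed.

(** * Gaussian integers as algebraic numbers *)

Definition gauss_algC (z : gauss) : algC := (gre z)%:~R + 'i * (gim z)%:~R.

Fact gauss_algC_additive : zmod_morphism gauss_algC.
Proof. by move=> z w; rewrite /gauss_algC !gaussE !rmorphD !rmorphN; ring. Qed.
HB.instance Definition _ :=
  GRing.isZmodMorphism.Build gauss algC gauss_algC gauss_algC_additive.
Fact gauss_algC_multiplicative : monoid_morphism gauss_algC.
Proof.
split=> [|z w]; first by rewrite /gauss_algC mulr0 addr0.
rewrite /gauss_algC !gaussE !rmorphD rmorphN !rmorphM /=.
have i2 : 'i * 'i = -1 :> algC by rewrite -expr2 sqrCi.
ring: i2.
Qed.
HB.instance Definition _ :=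
  GRing.isMonoidMorphism.Build gauss algC gauss_algC gauss_algC_multiplicative.

Lemma gauss_algC_conj z : gauss_algC (gconj z) = (gauss_algC z)^*.
Proof.
by rewrite /gauss_algC !gaussE rmorphD rmorphM /= !rmorph_int conjCi rmorphN; ring.
Qed.

Lemma gauss_algC_int (n : int) : gauss_algC n%:~R = n%:~R.
Proof. by rewrite rmorph_int. Qed.

Lemma gauss_algC_in z : gauss_algC z \is a gaussInt.
Proof.
by rewrite qualifE Re_rect ?Im_rect ?Rreal_int ?intr_int.
Qed.

Definition algC_gauss (z : algC) := Gauss (Num.floor ('Re z)) (Num.floor ('Im z)).

Lemma algC_gaussK : {in gaussInt, cancel algC_gauss gauss_algC}.
Proof.
by move=> z /andP[re im]; rewrite /gauss_algC /= !floorK // -Crect.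
Qed.

Lemma gauss_algC_inj : injective gauss_algC.
Proof.
move=> z w h; apply: gauss_eqP; apply: (@intr_inj algC).
  have := congr1 (fun x => 'Re x) h; rewrite /gauss_algC !Re_rect //; exact: Rreal_int.
have := congr1 (fun x => 'Im x) h; rewrite /gauss_algC !Im_rect //; exact: Rreal_int.
Qed.

Lemma map_gauss_eq0 m n (B : 'M[gauss]_(m, n)) :
  (map_mx gauss_algC B == 0) = (B == 0).
Proof.
apply/eqP/eqP => [/matrixP h|->]; last exact: map_mx0.
by apply/matrixP=> i j; apply: gauss_algC_inj; have := h i j; rewrite !mxE rmorph0.
Qed.

Lemma mxOver_gauss m n (A : 'M[algC]_(m, n)) :
  A \is a mxOver gaussInt -> exists B, A = map_mx gauss_algC B.
Proof.
move=> /mxOverP hA; exists (map_mx algC_gauss A).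
by apply/matrixP=> i j; rewrite !mxE algC_gaussK.
Qed.

Lemma map_gauss_over m n (B : 'M[gauss]_(m, n)) :
  map_mx gauss_algC B \is a mxOver gaussInt.
Proof. by apply/mxOverP=> i j; rewrite mxE gauss_algC_in. Qed.

Lemma map_gauss_conj m n (B : 'M[gauss]_(m, n)) :
  (map_mx gauss_algC B) ^t* = map_mx gauss_algC (map_mx gconj B)^T.
Proof. by apply/matrixP=> i j; rewrite !mxE gauss_algC_conj. Qed.

Lemma lattice_form_map n (M : 'M[gauss]_n) x y :
  lattice_form (map_mx gauss_algC M) (map_mx gauss_algC x) (map_mx gauss_algC y) =
  gauss_algC (hform M x y).
Proof. by rewrite /lattice_form map_gauss_conj -!map_mxM mxE. Qed.

Lemma hermsymmx_map n (M : 'M[gauss]_n) :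
  map_mx gauss_algC M \is hermsymmx <-> self_adjoint M.
Proof.
split=> [/is_hermitianmxP|adjM]; last first.
  by apply/is_hermitianmxP; rewrite expr0 scale1r map_gauss_conj -adjM.
rewrite expr0 scale1r map_gauss_conj => /matrixP h; apply/matrixP=> i j.
by apply: gauss_algC_inj; have := h i j; rewrite !mxE.
Qed.

Lemma gauss_algC_gt0 z : 0 < gauss_algC z -> 0 < gre z /\ gim z = 0.
Proof.
move=> z0; have zre : gauss_algC z \is Num.real by rewrite realE ltW.
have im0 : gim z = 0.
  apply: (@intr_inj algC); have /Creal_ImP := zre.
  by rewrite /gauss_algC Im_rect //; exact: Rreal_int.
by split=> //; move: z0; rewrite /gauss_algC im0 mulr0 addr0 ltr0z.
Qed.

Lemma row4E (x : 'rV[gauss]_4) :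
  x = row4 (x 0 0) (x 0 1) (x 0 2%:R) (x 0 3%:R).
Proof.
apply/matrixP=> i j; rewrite mxE (ord1 i).
by case: j => [[|[|[|[|?]]]] ?] //=; congr (x 0 _); apply: val_inj.
Qed.

(** The second summand contributes |x3|^2 + |x4|^2 + |x3 + x4|^2. *)
Lemma target_posdef (x : 'rV[gauss]_4) : x != 0 ->
  exists2 k : int, 0 < k & hform target_gram x x = k%:~R.
Proof.
rewrite (row4E x); move: (x 0 0) (x 0 1) (x 0 2%:R) (x 0 3%:R) => x1 x2 x3 x4 nz.
exists (gnorm x1 + gnorm x2 + gnorm x3 + gnorm x4 + gnorm (x3 + x4)); last first.
  by rewrite hform_target; apply: gauss_eqP; rewrite /gnorm !gaussE /=; lia.
rewrite ltNge; apply: contra nz => h.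
have := (gnorm_ge0 x1, gnorm_ge0 x2, gnorm_ge0 x3, gnorm_ge0 x4, gnorm_ge0 (x3 + x4)).
move=> [[[[h1 h2] h3] h4] h5].
have -> : x1 = 0 by apply: gnorm_eq0; lia.
have -> : x2 = 0 by apply: gnorm_eq0; lia.
have -> : x3 = 0 by apply: gnorm_eq0; lia.
have -> : x4 = 0 by apply: gnorm_eq0; lia.
by apply/eqP/matrixP=> i j; rewrite !mxE; case: j => [[|[|[|[|?]]]] ?].
Qed.

Lemma target_gram_map : orthogonal_sum (diag_lattice [tuple 1; 1]) (gram2 2 1 1 2)
  = map_mx gauss_algC target_gram.
Proof.
apply/matrixP=> i j; rewrite !mxE.
case: (splitP i) => -[[|[|?]] // ?] /= ei; rewrite !mxE;
case: (splitP j) => -[[|[|?]] // ?] /= ej; rewrite !mxE ei ej /=;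
rewrite ?rmorph0 ?rmorph1 //.
all: try by rewrite (tnth_nth 0).
all: by rewrite -[2]/(2%:R) rmorph_nat.
Qed.

Lemma mulmx_hform m n (M : 'M[gauss]_n) (X : 'M[gauss]_(m, n)) i j :
  (X *m M *m (map_mx gconj X)^T) i j = hform M (row i X) (row j X).
Proof.
rewrite /hform -row_mul !mxE; apply: eq_bigr => k _.
by rewrite !mxE.
Qed.

(** The determinant is read off from the norm of (- conj b, a), which is
    a (a c - |b|^2). *)
Lemma posdef2_lattice (l : 'M[gauss]_2) : positive_lattice (map_mx gauss_algC l) ->
  [/\ l 0 0 = (gre (l 0 0))%:~R, l 1 1 = (gre (l 1 1))%:~R, l 1 0 = gconj (l 0 1)
    & posdef2 (gre (l 0 0)) (l 0 1) (gre (l 1 1))].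
Proof.
case=> [[_ /hermsymmx_map adjl] pos].
have l10 : l 1 0 = gconj (l 0 1) by rewrite {1}adjl !mxE.
pose row2 (x y : gauss) : 'rV[gauss]_2 := \row_i nth 0 [:: x; y] i.
have rowE x y : hform l (row2 x y) (row2 x y) =
    (x * l 0 0 + y * l 1 0) * gconj x + (x * l 0 1 + y * l 1 1) * gconj y.
  rewrite /hform mxE !big_ord_recl big_ord0 !mxE !big_ord_recl !big_ord0 !mxE /=.
  by rewrite !addr0; congr ((_ * l _ _ + _ * l _ _) * _ + (_ * l _ _ + _ * l _ _) * _);
    apply: val_inj.
have diag (i : 'I_2) : l i i = (gre (l i i))%:~R.
  apply: gauss_eqP; rewrite ?gre_int ?gim_int //.
  by have := congr1 (fun A : 'M_2 => gim (A i i)) adjl; rewrite !mxE /=; lia.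
have posrow x y : row2 x y != 0 -> 0 < gre (hform l (row2 x y) (row2 x y)).
  move=> nz; have := pos (map_mx gauss_algC (row2 x y)) (map_gauss_over _).
  rewrite lattice_form_map map_gauss_eq0 => /(_ nz); by case/gauss_algC_gt0.
split=> //.
have a0 : 0 < gre (l 0 0).
  have := posrow 1 0; rewrite rowE !gaussE => h.
  have : row2 1 0 != 0 by apply/eqP=> /matrixP/(_ 0 0); rewrite !mxE.
  by move/h; lia.
split=> //.
have := posrow (- gconj (l 0 1)) (l 0 0); rewrite rowE l10.
have -> : (- gconj (l 0 1) * l 0 0 + l 0 0 * gconj (l 0 1)) = 0 by ring.
rewrite mul0r add0r mulNr (mulrC (gconj _)) mul_gconj (diag 0) (diag 1) gconj_int.
rewrite -intrM -intrN -intrD -intrM gre_int !gre_int => h.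
have : row2 (- gconj (l 0 1)) (gre (l 0 0))%:~R != 0.
  by apply/eqP=> /matrixP/(_ 0 1)/(congr1 gre); rewrite !mxE /= gre_int => e; move: a0; rewrite e.
by move/h; nia.
Qed.

Theorem theorem5 :
  two_universal (orthogonal_sum (diag_lattice [tuple 1; 1]) (gram2 2 1 1 2)).
Proof.
rewrite target_gram_map; split.
  split; first by split; [exact: map_gauss_over | apply/hermsymmx_map/self_adjoint_target].
  move=> _ /mxOver_gauss[x ->]; rewrite map_gauss_eq0 => nz.
  have [k k0 xx] := target_posdef nz.
  by rewrite lattice_form_map xx gauss_algC_int ltr0z.
move=> l0 pos_l; have [/mxOver_gauss[l lE] _] := pos_l.1.
rewrite {}lE in pos_l *.
have [l00 l11 l10 pos] := posdef2_lattice pos_l.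
have [x [y [xx xy yy]]] := target_has_gram2 pos.
pose X : 'M[gauss]_(2, 4) := \matrix_(i, j) (if i == 0 then x else y) 0 j.
exists (map_mx gauss_algC X); first exact: map_gauss_over.
have rowX i : row i X = if i == 0 then x else y.
  by apply/matrixP=> i' j; rewrite !mxE (ord1 i').
rewrite map_gauss_conj -!map_mxM; congr map_mx; apply/matrixP=> i j.
rewrite mulmx_hform !rowX.
have ord2 (k : 'I_2) : k = 0 \/ k = 1.
  by case: k => [[|[|?]] // ?]; [left | right]; apply: val_inj.
case: (ord2 i) => ->; case: (ord2 j) => -> /=.
- by rewrite xx.
- by rewrite xy.
- by rewrite (hformC self_adjoint_target x) xy.
- by rewrite yy.
Qed.
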